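(* Suppose that (a) $f:\mathbb{R}^n\to\mathbb{R}$ is twice continuously differentiable and $\sigma_f$-weakly convex (i.e. $f(x)+(\sigma_f/2)\|x\|^2$ is convex), $\nabla f$ is Lipschitz continuous with modulus $\ell_f$, and $\nabla^2 f$ is Lipschitz continuous with modulus $L_f$; (b) $A\in\mathbb{R}^{m\times n}$ has full row rank, with $\gamma>0$ defined by $\gamma^2:=\lambda_{\min}(AA^\top)$; (c) $f$ is coercive, i.e. $f(x)\to\infty$ as $\|x\|\to\infty$; and (d) the parameters satisfy $\mu>\sigma_f$ and $$c_3:=\frac{\mu+\ell_f+c_1}{\gamma},\quad c_4:=\frac{\mu+c_1}{\gamma},\quad \rho>\max\left\{\frac{8(c_3^2+c_4^2)}{\mu},\frac{4\ell_f}{\gamma^2}\right\},\quad \beta:=\frac{4c_4^2}{\rho}.$$ Let $\{(x^k,u^k,y^k)\}$ be the sequence generated by iNALM for the problem (P): $\min_{x,u} f(x)+\lambda h(u)$ subject to $Ax+b=u$, and let $(x^*,u^*,y^* )$ be one of its accumulation points at which the second-order sufficient condition $d^\top\nabla^2f(x^* )d>0$ for all $d\in\mathcal C^*\setminus\{0\}$ holds. Let $\mathcal V_k:=\mathcal V_{\rho,\beta}(x^k,u^k,y^k,x^{k-1})$ and $\mathcal V_*:=\mathcal V_{\rho,\beta}(x^*,u^*,y^*,x^* )=f(x^* )+\lambda\|u^*_+\|_0$, and let $q\in(0,1)$, $c_\nu>0$ and $k_\nu$ be constants (which exist in this setting) such that $\mathcal V_k-\mathcal V_*\le c_\nu q^k$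 for all $k\ge k_\nu$. Then there exist a sufficiently large index $k^*$ and three positive constants $c_x$, $c_u$ and $c_y$ such that for any $k\ge k^*$, $$\|x^k-x^*\|\le c_x\sqrt q^{\,k},\qquad \|y^k-y^*\|\le c_y\sqrt q^{\,k},\qquad \|u^k-u^*\|\le c_u\sqrt q^{\,k}.$$
   Context: $[m]=\{1,\dots,m\}$; for $T\subseteq[m]$, $\overline T:=[m]\setminus T$, $v_T$ is the subvector of $v$ indexed by $T$ and $A_T$ the row-submatrix of $A$. $h(u):=\|u_+\|_0$ is the number of strictly positive entries of $u$. Data: $\lambda,\mu>0$, $b\in\mathbb{R}^m$. Cone: with $\mathcal I_0^*:=\{i\in[m]:u_i^*=0,\,y_i^*=0\}$ and $\mathcal I_+^*:=\{i\in[m]:u_i^*=0,\,y_i^*>0\}$, $\mathcal C^*:=\{d\in\mathbb{R}^n:A_{\mathcal I_+^*}d=0,\ A_{\mathcal I_0^*}d\le0\}$. Define $$\mathcal L_\rho(x,u,y):=f(x)+\langle y,Ax+b-u\rangle+\tfrac\rho2\|Ax+b-u\|^2+\lambda h(u),\qquad \mathcal V_{\rho,\theta}(x,u,y,v):=\mathcal L_\rho(x,u,y)+\tfrac\theta2\|x-v\|^2,$$ $$g_k(x,u):=f(x)+\langle y^k,Ax+b-u\rangle+\tfrac\rho2\|Ax+b-u\|^2+\tfrac\mu2\|x-x^k\|^2 .$$ $\overline\ell_g>0$ is a Lipschitz modulus of $\nabla g_k$ valid for all $k$; $\sigma_g:=\mu-\sigma_f$. GSNewton applied to a function $g$ (with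 $G:=g+\lambda h$), with $\alpha\in(0,1/\overline\ell_g)$, $t\in(0,2/\overline\ell_g)$ and starting point $\zeta^0$: for $j=0,1,\dots$, with $\zeta^j=(x^j,u^j)$, $y^j:=-\nabla_ug(\zeta^j)$: (1) $\Gamma_j:=\{i\in[m]:[u^j+\alpha y^j]_i\in[0,\sqrt{2\alpha\lambda})\}$; (2) $u^{j+1/2}_i:=0$ for $i\in\Gamma_j$, $u^{j+1/2}_i:=[u^j+\alpha y^j]_i$ for $i\notin\Gamma_j$, $x^{j+1/2}:=x^j-t\nabla_xg(x^j,u^{j+1/2})$, $\zeta^{j+1/2}:=(x^{j+1/2},u^{j+1/2})$; (3) $\widetilde\zeta^{j+1}=(x,u)$ solves $u_{\Gamma_j}=0$ and $H^{j+1/2}[x-x^{j+1/2};(u-u^{j+1/2})_{\overline\Gamma_j}]=-[\nabla_xg(\zeta^{j+1/2});(\nabla_ug(\zeta^{j+1/2}))_{\overline\Gamma_j}]$, where $H^{j+1/2}$ is the Hessian of $g$ at $\zeta^{j+1/2}$ in the variables $(x,u_{\overline\Gamma_j})$; (4) $\zeta^{j+1}:=\widetilde\zeta^{j+1}$ if $G(\zeta^{j+1/2})-G(\widetilde\zeta^{j+1})\ge(\sigma_g/4)\|\widetilde\zeta^{j+1}-\zeta^{j+1/2}\|^2$, and $\zeta^{j+1}:=\zeta^{j+1/2}$ otherwise. Residuals: with $\Gamma:=\{i\in[m]:[u-\alpha\nabla_ug_k(x,u)]_i\in[0,\sqrt{2\alpha\lambda})\}$, $\mathcal R_1(x,u):=\|\nabla_xg_k(x,u)\|$,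 $\mathcal R_2(x,u):=\|[u_\Gamma;\ \alpha(\nabla_ug_k(x,u))_{\overline\Gamma}]\|$, $\mathcal R_3(x,u):=\frac{\alpha^2}2\|\nabla_ug_k(x,u)\|^2+\alpha\lambda\|u_+\|_0-\Phi_{\alpha\lambda h(\cdot)}(u-\alpha\nabla_ug_k(x,u))$, where $\Phi_{\alpha\lambda h(\cdot)}(v):=\min_{z}\{\alpha\lambda h(z)+\frac12\|z-v\|^2\}$. Algorithm iNALM: given $\epsilon_k>0$ with $\epsilon_k\to0$, $c_1,c_2>0$ and $(x^0,u^0,y^0)$. At iteration $k=0,1,\dots$: apply GSNewton to $g_k$ from $(x^k,u^k)$, generating $(x^{k,j},u^{k,j})$; stop as soon as an index $j_k$ satisfies $$\mathcal R_1(x^{k,j_k},u^{k,j_k})\le c_1\|x^{k,j_k}-x^k\|,\quad \mathcal R_2(x^{k,j_k},u^{k,j_k})\le c_2\|x^{k,j_k}-x^k\|^2,\quad \mathcal R_3(x^{k,j_k},u^{k,j_k})\le\epsilon_k,$$ and set $(x^{k+1},u^{k+1}):=(x^{k,j_k},u^{k,j_k})$; then $y^{k+1}:=y^k+\rho(Ax^{k+1}+b-u^{k+1})$. If the $x$-part of the limit of the GSNewton sequence equals $x^k$, then $(x^{k+1},u^{k+1})$ is instead taken to be a P-stationary point of $\min g_k+\lambda h$ (that is, $\nabla_xg_k=0$ and $u\in\arg\min_z\{\alpha\lambda h(z)+\frac12\|z-(u-\alpha\nabla_ug_k(x,u))\|^2\}$ at that point) satisfying these three inequalities (with $(x^{k+1},u^{k+1})$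 in place of $(x^{k,j_k},u^{k,j_k})$). In all cases $\mathcal V_{\rho,\mu}(x^{k+1},u^{k+1},y^k,x^k)\le\mathcal V_{\rho,\mu}(x^k,u^k,y^k,x^k)$. *)

(* Defs.v *)
From HB Require Import structures.
From mathcomp Require Import all_boot all_order all_algebra.
From mathcomp Require Import all_classical all_reals all_analysis.

Set Implicit Arguments.
Unset Strict Implicit.
Unset Printing Implicit Defensive.

Import Order.TTheory GRing.Theory Num.Theory.
Import numFieldNormedType.Exports.

Local Open Scope classical_set_scope.
Local Open Scope ring_scope.

Definition edot {R : realType} {n} (v w : 'cV[R]_n) : R :=
  \sum_(i < n) v i 0 * w i 0.

(* The library norm on matrices is the sup norm, so the Euclidean norm, on which
   all the moduli depend, is introduced separately (the topology is the same). *)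
Definition enorm {R : realType} {n} (v : 'cV[R]_n) : R :=
  Num.sqrt (\sum_(i < n) v i 0 ^+ 2).

(* The spectral norm, as the operator norm for enorm. *)
Definition opnorm {R : realType} {p n} (M : 'M[R]_(p, n)) : R :=
  sup [set enorm (M *m d) | d in [set d : 'cV[R]_n | enorm d <= 1]].

Definition min_eigenvalue {R : realType} {n} (M : 'M[R]_n) (a : R) : Prop :=
  eigenvalue M a /\ forall a' : R, eigenvalue M a' -> a <= a'.

(* The submatrix A_T of the rows of A with index in T; v_T for a column v. *)
Definition rows_of {R : realType} {m p} (T : {set 'I_m}) (A : 'M[R]_(m, p)) :
  'M[R]_(#|T|, p) := rowsub (@enum_val _ (mem T)) A.

Definition cols_of {R : realType} {m p} (T : {set 'I_m}) (A : 'M[R]_(p, m)) :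
  'M[R]_(p, #|T|) := colsub (@enum_val _ (mem T)) A.

Definition grad {R : realType} {n} (F : 'cV[R]_n -> R) (x : 'cV[R]_n) :
  'cV[R]_n := \col_i 'D_(delta_mx i 0) F x.

Definition hess {R : realType} {n} (F : 'cV[R]_n -> R) (x : 'cV[R]_n) :
  'M[R]_n := \matrix_(i, j) 'D_(delta_mx j 0) (fun z => grad F z i 0) x.

Definition twice_cont_diff {R : realType} {n} (F : 'cV[R]_n -> R) : Prop :=
  [/\ forall x, differentiable F x,
      forall x, differentiable (grad F) x &
      continuous (hess F)].

Definition elipschitz {R : realType} {n p} (L : R)
  (F : 'cV[R]_n -> 'cV[R]_p) : Prop :=
  forall x x', enorm (F x - F x') <= L * enorm (x - x').

Definition hess_lipschitz {R : realType} {n} (L : R) (F : 'cV[R]_n -> R) :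
  Prop :=
  forall x x', opnorm (hess F x - hess F x') <= L * enorm (x - x').

Definition weakly_convex {R : realType} {n} (sigma : R) (F : 'cV[R]_n -> R) :
  Prop :=
  convex_function [set: convex_lmodType 'cV[R]_n]
    (fun x => F x + sigma / 2 * enorm (x : 'cV[R]_n) ^+ 2).

Definition coercive {R : realType} {n} (F : 'cV[R]_n -> R) : Prop :=
  forall M : R, exists r : R, forall x, r < enorm x -> M < F x.

Definition stacked {R : realType} {n m} (g : 'cV[R]_n -> 'cV[R]_m -> R)
  (z : 'cV[R]_(n + m)) : R := g (usubmx z) (dsubmx z).

Definition gradx {R : realType} {n m} (g : 'cV[R]_n -> 'cV[R]_m -> R) x u :
  'cV[R]_n := grad (fun x' => g x' u) x.

Definition gradu {R : realType} {n m} (g : 'cV[R]_n -> 'cV[R]_m -> R) x u :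
  'cV[R]_m := grad (g x) u.

(* The Hessian at (x, u) in the variables (x, u_T): the blocks of the full
   Hessian, with the rows and columns of the u-part restricted to T. *)
Definition hess_on {R : realType} {n m} (g : 'cV[R]_n -> 'cV[R]_m -> R)
  (T : {set 'I_m}) x u : 'M[R]_(n + #|T|) :=
  let H := hess (stacked g) (col_mx x u) in
  block_mx (ulsubmx H) (cols_of T (ursubmx H))
           (rows_of T (dlsubmx H)) (rows_of T (cols_of T (drsubmx H))).

Definition h {R : realType} {m} (u : 'cV[R]_m) : R :=
  #|[set i | 0 < u i 0]%SET|%:R.

Definition augL {R : realType} {n m} (f : 'cV[R]_n -> R) (A : 'M[R]_(m, n))
  (b : 'cV[R]_m) (lambda rho : R) (x : 'cV[R]_n) (u y : 'cV[R]_m) : R :=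
  f x + edot y (A *m x + b - u) + rho / 2 * enorm (A *m x + b - u) ^+ 2
  + lambda * h u.

Definition merit {R : realType} {n m} (f : 'cV[R]_n -> R) (A : 'M[R]_(m, n))
  (b : 'cV[R]_m) (lambda rho theta : R) (x : 'cV[R]_n) (u y : 'cV[R]_m)
  (v : 'cV[R]_n) : R :=
  augL f A b lambda rho x u y + theta / 2 * enorm (x - v) ^+ 2.

(* g_k, with (xk, yk) standing for (x^k, y^k). *)
Definition subproblem {R : realType} {n m} (f : 'cV[R]_n -> R)
  (A : 'M[R]_(m, n)) (b : 'cV[R]_m) (rho mu : R) (xk : 'cV[R]_n)
  (yk : 'cV[R]_m) (x : 'cV[R]_n) (u : 'cV[R]_m) : R :=
  f x + edot yk (A *m x + b - u) + rho / 2 * enorm (A *m x + b - u) ^+ 2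
  + mu / 2 * enorm (x - xk) ^+ 2.

Definition critical_cone {R : realType} {n m} (A : 'M[R]_(m, n))
  (u y : 'cV[R]_m) : set 'cV[R]_n :=
  let I0 := [set i | (u i 0 == 0) && (y i 0 == 0)]%SET in
  let Ip := [set i | (u i 0 == 0) && (0 < y i 0)]%SET in
  [set d | rows_of Ip A *m d = 0 /\ forall i, (rows_of I0 A *m d) i 0 <= 0].

Definition prox_obj {R : realType} {m} (alpha lambda : R) (v z : 'cV[R]_m) : R :=
  alpha * lambda * h z + 1 / 2 * enorm (z - v) ^+ 2.

(* The Moreau envelope of alpha lambda h.  Its defining minimum is attained for
   alpha, lambda >= 0, so that inf is min. *)
Definition envelope {R : realType} {m} (alpha lambda : R) (v : 'cV[R]_m) : R :=
  inf (range (prox_obj alpha lambda v)).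

Definition prox {R : realType} {m} (alpha lambda : R) (v : 'cV[R]_m) :
  set 'cV[R]_m :=
  [set z | forall z', prox_obj alpha lambda v z <= prox_obj alpha lambda v z'].

Definition P_stationary {R : realType} {n m} (g : 'cV[R]_n -> 'cV[R]_m -> R)
  (alpha lambda : R) (x : 'cV[R]_n) (u : 'cV[R]_m) : Prop :=
  gradx g x u = 0 /\ prox alpha lambda (u - alpha *: gradu g x u) u.

Definition Gam {R : realType} {n m} (g : 'cV[R]_n -> 'cV[R]_m -> R)
  (alpha lambda : R) (x : 'cV[R]_n) (u : 'cV[R]_m) : {set 'I_m} :=
  [set i | 0 <= (u - alpha *: gradu g x u) i 0
             < Num.sqrt (2 * alpha * lambda)]%SET.

(* One iteration (x, u) |-> (x', u').  (xh, uh) is the half step and (xt, ut) the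
   Newton point. *)
Definition gsnewton_step {R : realType} {n m} (g : 'cV[R]_n -> 'cV[R]_m -> R)
  (lambda sigma alpha t : R) (x : 'cV[R]_n) (u : 'cV[R]_m)
  (x' : 'cV[R]_n) (u' : 'cV[R]_m) : Prop :=
  let y := - gradu g x u in
  let Ga := Gam g alpha lambda x u in
  let uh := \col_i (if i \in Ga then 0 else (u + alpha *: y) i 0) in
  let xh := x - t *: gradx g x uh in
  let G := fun x u => g x u + lambda * h u in
  exists (xt : 'cV[R]_n) (ut : 'cV[R]_m),
    [/\ rows_of Ga ut = 0,
        hess_on g (~: Ga)%SET xh uh
          *m col_mx (xt - xh) (rows_of (~: Ga)%SET (ut - uh))
        = - col_mx (gradx g xh uh) (rows_of (~: Ga)%SET (gradu g xh uh)) &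
        (x', u') =
          if sigma / 4 * enorm (col_mx xt ut - col_mx xh uh) ^+ 2
             <= G xh uh - G xt ut
          then (xt, ut) else (xh, uh)].

Definition gsnewton_seq {R : realType} {n m} (g : 'cV[R]_n -> 'cV[R]_m -> R)
  (lambda sigma alpha t : R) (x0 : 'cV[R]_n) (u0 : 'cV[R]_m)
  (zx : nat -> 'cV[R]_n) (zu : nat -> 'cV[R]_m) : Prop :=
  [/\ zx 0%N = x0, zu 0%N = u0 &
      forall j, gsnewton_step g lambda sigma alpha t
                  (zx j) (zu j) (zx j.+1) (zu j.+1)].

Definition res1 {R : realType} {n m} (g : 'cV[R]_n -> 'cV[R]_m -> R) x u : R :=
  enorm (gradx g x u).

Definition res2 {R : realType} {n m} (g : 'cV[R]_n -> 'cV[R]_m -> R)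
  (alpha lambda : R) x u : R :=
  let Ga := Gam g alpha lambda x u in
  enorm (col_mx (rows_of Ga u) (alpha *: rows_of (~: Ga)%SET (gradu g x u))).

Definition res3 {R : realType} {n m} (g : 'cV[R]_n -> 'cV[R]_m -> R)
  (alpha lambda : R) x u : R :=
  alpha ^+ 2 / 2 * enorm (gradu g x u) ^+ 2 + alpha * lambda * h u
  - envelope alpha lambda (u - alpha *: gradu g x u).

Definition stop_test {R : realType} {n m} (g : 'cV[R]_n -> 'cV[R]_m -> R)
  (alpha lambda c1 c2 eps : R) (xk : 'cV[R]_n) (x : 'cV[R]_n) (u : 'cV[R]_m) :
  Prop :=
  [/\ res1 g x u <= c1 * enorm (x - xk),
      res2 g alpha lambda x u <= c2 * enorm (x - xk) ^+ 2 &
      res3 g alpha lambda x u <= eps].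

(* (x, u, y) is generated by iNALM.  (zx, zu) is the GSNewton sequence of the
   k-th subproblem; it is prolonged past the stopping index since the rule
   refers to its limit. *)
Definition inalm {R : realType} {n m} (f : 'cV[R]_n -> R) (A : 'M[R]_(m, n))
  (b : 'cV[R]_m) (lambda rho mu sigmaf alpha t c1 c2 : R) (eps : nat -> R)
  (x : nat -> 'cV[R]_n) (u y : nat -> 'cV[R]_m) : Prop :=
  forall k : nat,
    let g := subproblem f A b rho mu (x k) (y k) in
    let stop := stop_test g alpha lambda c1 c2 (eps k) (x k) in
    exists (zx : nat -> 'cV[R]_n) (zu : nat -> 'cV[R]_m),
      let stalled := exists ubar : 'cV[R]_m,
        (zx j @[j --> \oo] --> x k) /\ (zu j @[j --> \oo] --> ubar) in
      [/\ gsnewton_seq g lambda (mu - sigmaf) alpha t (x k) (u k) zx zu,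
          ~ stalled -> exists jk : nat,
            [/\ stop (zx jk) (zu jk),
                forall j, (j < jk)%N -> ~ stop (zx j) (zu j),
                x k.+1 = zx jk & u k.+1 = zu jk],
          stalled -> P_stationary g alpha lambda (x k.+1) (u k.+1)
                     /\ stop (x k.+1) (u k.+1),
          y k.+1 = y k + rho *: (A *m x k.+1 + b - u k.+1) &
          merit f A b lambda rho mu (x k.+1) (u k.+1) (y k) (x k)
          <= merit f A b lambda rho mu (x k) (u k) (y k) (x k)].

(* Main.v *)
(* With D_k = |x^{k+1} - x^k|, the step inequality for V_{rho,mu} and the dual
   estimate |y^{k+2} - y^{k+1}| <= c3 D_{k+1} + c4 D_k give
   V_{k+1} + (mu/4) D_k^2 <= V_k.  The augmented Lagrangian being lower
   semicontinuous (h is not continuous), V_* is a lower bound of the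
   nonincreasing sequence V_k, hence (mu/4) D_k^2 <= V_k - V_* <= c_nu q^k.
   The steps of x, then of y by the dual estimate, then of
   u^{k+1} = A x^{k+1} + b - (y^{k+1} - y^k) / rho, are thus O(sqrt q ^ k), and
   summing the geometric tails along a sequence approaching its cluster point
   gives the rates. *)
Require Import Defs.
From HB Require Import structures.
From mathcomp Require Import all_boot all_order all_algebra.
From mathcomp Require Import all_classical all_reals all_analysis.
From mathcomp Require Import ring lra.

Set Implicit Arguments.
Unset Strict Implicit.
Unset Printing Implicit Defensive.

Import Order.TTheory GRing.Theory Num.Theory.
Import numFieldNormedType.Exports.

Local Open Scope classical_set_scope.
Local Open Scope ring_scope.

(** * Euclidean inner product and norm *)

Section Euclidean.
Context {R : realType}.

Lemma edotC n (v w : 'cV[R]_n) : edot v w = edot w v.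
Proof. by apply: eq_bigr => i _; rewrite mulrC. Qed.

Lemma edotDl n (v v' w : 'cV[R]_n) : edot (v + v') w = edot v w + edot v' w.
Proof. by rewrite -big_split; apply: eq_bigr => i _; rewrite mxE mulrDl. Qed.

Lemma edotZl n a (v w : 'cV[R]_n) : edot (a *: v) w = a * edot v w.
Proof. by rewrite mulr_sumr; apply: eq_bigr => i _; rewrite mxE mulrA. Qed.

Lemma edotDr n (v w w' : 'cV[R]_n) : edot v (w + w') = edot v w + edot v w'.
Proof. by rewrite edotC edotDl !(edotC v). Qed.

Lemma edotZr n a (v w : 'cV[R]_n) : edot v (a *: w) = a * edot v w.
Proof. by rewrite edotC edotZl (edotC v). Qed.

Lemma edot0l n (v : 'cV[R]_n) : edot 0 v = 0.
Proof. by rewrite /edot big1// => i _; rewrite mxE mul0r. Qed.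

Lemma edot_mulmx n m (M : 'M[R]_(m, n)) v w :
  edot v (M *m w) = edot (M^T *m v) w.
Proof.
have edotE k (a c : 'cV[R]_k) : edot a c = (a^T *m c) 0 0.
  by rewrite mxE; apply: eq_bigr => i _; rewrite mxE.
by rewrite !edotE trmx_mul trmxK mulmxA.
Qed.

Lemma edot_delta n (v : 'cV[R]_n) i : edot v (delta_mx i 0) = v i 0.
Proof.
rewrite /edot (bigD1 i)//= big1 ?addr0 => [|j ji]; first by rewrite mxE !eqxx mulr1.
by rewrite mxE (negPf ji) mulr0.
Qed.

Lemma enorm_ge0 n (v : 'cV[R]_n) : 0 <= enorm v.
Proof. exact: sqrtr_ge0. Qed.

Lemma sqr_enorm n (v : 'cV[R]_n) : enorm v ^+ 2 = edot v v.
Proof.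
rewrite sqr_sqrtr; first by apply: eq_bigr => i _.
by apply: sumr_ge0 => i _; exact: sqr_ge0.
Qed.

Lemma enorm_eq0 n (v : 'cV[R]_n) : enorm v = 0 -> v = 0.
Proof.
move=> v0; have /eqP := sqr_enorm v; rewrite v0 expr0n /= eq_sym.
rewrite psumr_eq0 => [/allP v00|i _]; last exact: sqr_ge0.
apply/colP => i; have := v00 i (mem_index_enum i).
by rewrite mxE /= -expr2 sqrf_eq0 => /eqP.
Qed.

Lemma enorm0 n : enorm (0 : 'cV[R]_n) = 0.
Proof. by rewrite /enorm big1 ?sqrtr0// => i _; rewrite mxE expr0n. Qed.

(** Cauchy-Schwarz: the square of the norm of [enorm w *: v - enorm v *: w] factors as [2 * (enorm v
    * enorm w) * (enorm v * enorm w - edot v w)]. *)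
Lemma edot_le_enorm n (v w : 'cV[R]_n) : edot v w <= enorm v * enorm w.
Proof.
have [/enorm_eq0 ->|v0] := eqVneq (enorm v) 0.
  by rewrite edot0l enorm0 mul0r.
have [/enorm_eq0 ->|w0] := eqVneq (enorm w) 0.
  by rewrite edotC edot0l enorm0 mulr0.
have v_gt0 : 0 < enorm v by rewrite lt_def v0 enorm_ge0.
have w_gt0 : 0 < enorm w by rewrite lt_def w0 enorm_ge0.
have := sqr_ge0 (enorm (enorm w *: v + - enorm v *: w)).
rewrite sqr_enorm !(edotDl, edotDr, edotZl, edotZr) (edotC w v) -!sqr_enorm.
rewrite (_ : _ + _ = 2 * (enorm v * enorm w) * (enorm v * enorm w - edot v w)); last by ring.
by rewrite pmulr_rge0 ?subr_ge0// !mulr_gt0.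
Qed.

Lemma enormN n (v : 'cV[R]_n) : enorm (- v) = enorm v.
Proof. by congr Num.sqrt; apply: eq_bigr => i _; rewrite mxE sqrrN. Qed.

Lemma enormZ n a (v : 'cV[R]_n) : 0 <= a -> enorm (a *: v) = a * enorm v.
Proof.
move=> a0; apply/eqP; rewrite -(@eqrXn2 _ 2) ?mulr_ge0 ?enorm_ge0// exprMn !sqr_enorm.
by rewrite edotZl edotZr mulrA.
Qed.

Lemma enormD n (v w : 'cV[R]_n) : enorm (v + w) <= enorm v + enorm w.
Proof.
rewrite -ler_sqr ?nnegrE ?addr_ge0 ?enorm_ge0// sqrrD !sqr_enorm.
rewrite edotDl !edotDr (edotC w v); have := edot_le_enorm v w; lra.
Qed.

Lemma enormB n (v w : 'cV[R]_n) : enorm (v - w) <= enorm v + enorm w.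
Proof. by rewrite -(enormN w) enormD. Qed.

Lemma enorm_distC n (v w : 'cV[R]_n) : enorm (v - w) = enorm (w - v).
Proof. by rewrite -enormN opprB. Qed.

(** The Frobenius norm serves as [C], by Cauchy-Schwarz on each row. *)
Lemma enorm_mulmx_bounded m n (M : 'M[R]_(m, n)) :
  exists2 C, 0 <= C & forall v, enorm (M *m v) <= C * enorm v.
Proof.
exists (Num.sqrt (\sum_i enorm (row i M)^T ^+ 2)); first exact: sqrtr_ge0.
move=> v; have ge0 : 0 <= \sum_i enorm (row i M)^T ^+ 2.
  by apply: sumr_ge0 => i _; exact: sqr_ge0.
rewrite -ler_sqr ?nnegrE ?mulr_ge0 ?enorm_ge0 ?sqrtr_ge0// exprMn (sqr_sqrtr ge0).
rewrite sqr_enorm mulr_suml; apply: ler_sum => i _.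
have -> : (M *m v) i 0 = edot (row i M)^T v.
  by rewrite mxE; apply: eq_bigr => j _; rewrite !mxE.
rewrite -expr2 -exprMn -ler_sqrt ?exprn_ge0 ?mulr_ge0 ?enorm_ge0//.
rewrite !sqrtr_sqr [leRHS]ger0_norm ?mulr_ge0 ?enorm_ge0// ler_norml.
rewrite edot_le_enorm andbT lerNl -mulN1r -edotZl scaleN1r.
by rewrite (le_trans (edot_le_enorm _ _))// enormN.
Qed.


(** * Continuity, lower semicontinuity and cluster points *)

Lemma continuous_edot (T : topologicalType) n (F G : T -> 'cV[R]_n) :
  (forall i, continuous (fun z => F z i 0)) ->
  (forall i, continuous (fun z => G z i 0)) ->
  continuous (fun z => edot (F z) (G z)).
Proof.
move=> cF cG; apply: (continuous_big (op := +%R)).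
  exact: add_continuous.
by move=> i _ z; apply: cvgM; [exact: cF | exact: cG].
Qed.

Lemma continuous_mulmx_coord (T : topologicalType) m n (M : 'M[R]_(m, n))
    (F : T -> 'cV[R]_n) i :
  (forall j, continuous (fun z => F z j 0)) ->
  continuous (fun z => (M *m F z) i 0).
Proof.
move=> cF; under eq_fun do rewrite mxE.
apply: (continuous_big (op := +%R)); first exact: add_continuous.
by move=> j _ z; apply: cvgM; [exact: cvg_cst | exact: cF].
Qed.

(** Links Euclidean balls to the sup-norm topology: the squared Euclidean distance to [p] is a
    continuous function of the coordinates. *)
Lemma near_enorm_lt n (p : 'cV[R]_n) e : 0 < e ->
  \forall z \near p, enorm (z - p) < e.
Proof.
move=> e0.
have c : continuous (fun z : 'cV[R]_n => edot (z - p) (z - p)).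
  have coord i : continuous (fun z : 'cV[R]_n => (z - p) i 0).
    under eq_fun do rewrite !mxE.
    by move=> z; apply: continuousB; [exact: coord_continuous | exact: cst_continuous].
  exact: continuous_edot.
have e2 : edot (p - p) (p - p) < e ^+ 2.
  by rewrite -sqr_enorm subrr enorm0 expr0n exprn_gt0.
near=> z.
rewrite -ltr_sqr ?nnegrE ?enorm_ge0 ?(ltW e0)// sqr_enorm.
near: z; exact: (cvgr_lt _ (c p) _ e2).
Unshelve. all: by end_near. Qed.

(** Each positive entry of [p] stays positive nearby, so the count cannot drop. *)
Lemma h_lsc m (p : 'cV[R]_m) : \forall z \near p, h p <= h z.
Proof.
have near_gt0 i : nbhs p [set z : 'cV[R]_m | 0 < p i 0 -> 0 < z i 0].
  have [pi|/negP pi] := boolP (0 < p i 0); last by apply: filterE => z.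
  by apply: filterS (cvgr_gt _ (@coord_continuous _ _ _ i 0 p) _ pi) => z /= ? _.
apply: filterS (filter_forall _ near_gt0) => z pz.
rewrite ler_nat; apply: subset_leq_card.
by apply/fintype.subsetP => i; rewrite !inE; exact: pz.
Qed.

Lemma cluster_seq_nbhs (T : topologicalType) (w : nat -> T) p B K :
  cluster (w k @[k --> \oo]) p -> nbhs p B -> exists2 k, (K <= k)%N & B (w k).
Proof.
move=> wp pB.
have [|_ [[k /= Kk <-] Bk]] := wp [set w k | k in [set k | (K <= k)%N]] B _ pB.
  by exists K => // k /= Kk; exists k.
by exists k.
Qed.

(** The steps from [k] to [k + d] add up to at most a partial geometric sum. It then suffices that
    [w] comes near [ws] at some late index, so a cluster point is enough. *)
Lemma geometric_rate n (w : nat -> 'cV[R]_n) ws C r K :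
  0 <= C -> 0 <= r < 1 ->
  (forall k, (K <= k)%N -> enorm (w k.+1 - w k) <= C * r ^+ k) ->
  (forall e N, 0 < e -> exists2 k, (N <= k)%N & enorm (w k - ws) < e) ->
  forall k, (K <= k)%N -> enorm (w k - ws) <= C / (1 - r) * r ^+ k.
Proof.
move=> C0 /andP[r0 r1] wr wws k Kk.
have r'0 : 0 < 1 - r by rewrite subr_gt0.
have tail d : enorm (w (k + d)%N - w k) <= C / (1 - r) * (r ^+ k - r ^+ (k + d)).
  elim: d => [|d IH]; first by rewrite addn0 !subrr enorm0 mulr0.
  rewrite addnS -(subrKA (w (k + d)%N)) (le_trans (enormD _ _))//.
  apply: le_trans (lerD (wr _ (leq_trans Kk (leq_addr _ _))) IH) _.
  rewrite le_eqVlt; apply/orP; left; apply/eqP; rewrite exprS.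
  by field; exact: lt0r_neq0.
apply/ler_addgt0Pr => e e0.
have [j kj je] := wws e k e0; rewrite -(subnKC kj) in je.
rewrite -(subrKA (w (k + (j - k))%N)) (le_trans (enormD _ _))//.
apply: lerD (ltW je); rewrite enorm_distC (le_trans (tail _))//.
by rewrite ler_wpM2l ?divr_ge0 ?(ltW r'0)// lerBlDr lerDl exprn_ge0.
Qed.

(** * Smallest eigenvalues, and the gradient and semicontinuity of the objectives *)

(* The minimum of the quadratic form over the unit sphere is an eigenvalue. *)
Lemma rayleigh_min_eigenvalue n (M : 'M[R]_n) (a : R) :
  M^T = M -> (forall c, eigenvalue M c -> a <= c) ->
  forall v, a * edot v v <= edot v (M *m v).
Proof.
case: n M => [|n] M Msym Ma v.
  by rewrite /edot !big_ord0 mulr0.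
(* The sphere is made of row vectors, the form in which [eigenvalue] takes its eigenvectors. *)
pose S := [set w : 'rV[R]_n.+1 | edot w^T w^T = 1].
pose Q (w : 'rV[R]_n.+1) := edot w^T (M *m w^T).
have ctr i : continuous (fun w : 'rV[R]_n.+1 => w^T i 0).
  by under eq_fun do rewrite mxE; exact: coord_continuous.
have cQ : continuous Q by apply: continuous_edot => // i; exact: continuous_mulmx_coord.
have S0 : S !=set0.
  by exists (delta_mx 0 0); rewrite /S /= trmx_delta edot_delta mxE !eqxx.
have Sc : compact S.
  apply: bounded_closed_compact; last first.
    have -> : S = (fun w : 'rV[R]_n.+1 => edot w^T w^T) @^-1` [set 1] by [].
    by apply: closed_comp => [w _|]; [exact: continuous_edot | exact: closed_eq].
  exists 1; split=> // B B1 w Sw; apply: le_trans (ltW B1).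
  rewrite /Num.norm /= mx_normrE; apply/bigmax_leP; split => //= -[i j] _ /=.
  rewrite ord1 -(ler_pXn2r (n := 2)) ?nnegrE// expr1n real_normK ?num_real//.
  rewrite -Sw /edot (bigD1 j)//= mxE -expr2 lerDl.
  by apply: sumr_ge0 => k _; rewrite -expr2 sqr_ge0.
have [w] := compact_EVT_min S0 Sc (continuous_subspaceT cQ).
rewrite inE => Sw Qw; set c := Q w in Qw.
(* The minimum [c] over the sphere bounds the form everywhere by homogeneity. *)
have Q_ge z : 0 <= edot z (M *m z) - c * edot z z.
  have [/enorm_eq0 ->|z0] := eqVneq (enorm z) 0.
    by rewrite !edot0l mulr0 subrr.
  have z_gt0 : 0 < enorm z by rewrite lt_def z0 enorm_ge0.
  have /Qw : ((enorm z)^-1 *: z)^T \in S.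
    rewrite inE /S /= trmxK edotZl edotZr -sqr_enorm.
    by field.
  rewrite /Q trmxK -scalemxAr edotZl edotZr mulrA -expr2 exprVn mulrC.
  by rewrite ler_pdivlMr ?exprn_gt0// sqr_enorm subr_ge0.
pose N := M - c%:M.
have NE z : N *m z = M *m z - c *: z by rewrite mulmxBl mul_scalar_mx.
have Nsym : N^T = N by rewrite linearB /= tr_scalar_mx Msym.
have QN z : edot z (N *m z) = edot z (M *m z) - c * edot z z.
  by rewrite NE -scaleNr edotDr edotZr mulNr.
have Nw0 : edot w^T (N *m w^T) = 0 by rewrite QN Sw mulr1 subrr.
(* The form of [N] is nonnegative and vanishes at [w], so its first variation [l] there must
   vanish. *)
have Nw z : edot z (N *m w^T) = 0.
  set l := edot z _; apply/eqP/negPn/negP => l0.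
  pose s := edot z (N *m z).
  have s0 : 0 <= s by rewrite /s QN.
  have pos t : 0 <= 2 * t * l + t ^+ 2 * s.
    have := Q_ge (w^T + t *: z); rewrite -QN mulmxDr -scalemxAr.
    rewrite !(edotDl, edotDr, edotZl, edotZr) Nw0 -/s -/l.
    rewrite edot_mulmx Nsym (edotC _ z) -/l.
    by rewrite add0r expr2 => /le_trans; apply; rewrite le_eqVlt; apply/orP; left; apply/eqP; ring.
  have s1 : 0 < 1 + s by lra.
  (* The denominator [1 + s], rather than [s], also covers [s = 0]; the value is negative unless
     [l = 0]. *)
  have := pos (- l / (1 + s)).
  rewrite (_ : _ + _ = - (l ^+ 2 * ((2 + s) / (1 + s) ^+ 2))); last first.
    by field; exact: lt0r_neq0.
  have s2 : 0 < 2 + s by lra.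
  have l2 : 0 < l ^+ 2 by rewrite exprn_even_gt0.
  by rewrite oppr_ge0 leNgt mulr_gt0// divr_gt0// exprn_gt0.
have ac : a <= c.
  apply: Ma; apply/eigenvalueP; exists w.
    have : N *m w^T = 0.
      by apply/enorm_eq0/eqP; rewrite -sqrf_eq0 sqr_enorm Nw.
    rewrite NE => /eqP; rewrite subr_eq0 => /eqP /(congr1 trmx).
    by rewrite trmx_mul trmxK Msym linearZ /= trmxK.
  apply/eqP => w0; move: Sw; rewrite /S /= w0 trmx0 -sqr_enorm enorm0 expr0n.
  by move/eqP; rewrite eq_sym oner_eq0.
apply: le_trans (_ : c * edot v v <= _); last by rewrite -subr_ge0.
by rewrite ler_wpM2r// -sqr_enorm sqr_ge0.
Qed.

(** The squared norm of [A^T *m v] is the quadratic form of [A *m A^T] at [v]. This recovers a bound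
    on multipliers from one on their images under [A^T]. *)
Lemma enorm_trmx_ge m n (A : 'M[R]_(m, n)) g : 0 < g ->
  min_eigenvalue (A *m A^T) (g ^+ 2) ->
  forall v, g * enorm v <= enorm (A^T *m v).
Proof.
move=> g0 [_ gmin] v.
rewrite -ler_sqr ?nnegrE ?mulr_ge0 ?enorm_ge0 ?(ltW g0)// exprMn !sqr_enorm.
rewrite [leRHS]edot_mulmx trmxK mulmxA [leRHS]edotC.
by apply: rayleigh_min_eigenvalue => //; rewrite trmx_mul trmxK.
Qed.

Lemma is_derive_quadratic n (Q : 'cV[R]_n -> R) x v l s :
  (forall t, Q (t *: v + x) = Q x + t * l + t ^+ 2 * s) -> is_derive x v Q l.
Proof.
move=> QE.
have cvgQ : t^-1 *: ((Q \o shift x) (t *: v) - Q x) @[t --> 0^'] --> l.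
  have lim : (l + t * s) @[t --> 0^'] --> l.
    rewrite -[X in _ --> X]addr0 -[X in _ + X](mul0r s).
    apply: cvgD; first exact: cvg_cst.
    apply: cvgM; last exact: cvg_cst.
    by apply: cvg_within_filter; exact: cvg_id.
  apply: cvg_trans lim; apply: near_eq_cvg.
  near=> t.
  have t0 : t != 0 by near: t; exact: nbhs_dnbhs_neq.
  by rewrite /= QE /GRing.scale /=; field.
split; first by apply/cvg_ex; exists l.
exact: cvg_lim cvgQ.
Unshelve. all: by end_near. Qed.

(** All terms but [f] form a quadratic [Q], whose derivative is read off its expansion along a line.
    At the new iterate, the vector hit by [A^T] is the updated multiplier. *)
Lemma gradx_subproblem m n (f : 'cV[R]_n -> R) (A : 'M[R]_(m, n)) b rho mu
    xk yk (x : 'cV[R]_n) u :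
  differentiable f x ->
  gradx (subproblem f A b rho mu xk yk) x u =
  grad f x + (A^T *m (yk + rho *: (A *m x + b - u)) + mu *: (x - xk)).
Proof.
move=> df; set l := A^T *m _ + _ *: _.
pose Q (z : 'cV[R]_n) := edot yk (A *m z + b - u)
  + rho / 2 * enorm (A *m z + b - u) ^+ 2 + mu / 2 * enorm (z - xk) ^+ 2.
have QE v t : Q (t *: v + x) = Q x + t * edot l v
    + t ^+ 2 * (rho / 2 * edot (A *m v) (A *m v) + mu / 2 * edot v v).
  rewrite /Q mulmxDr -scalemxAr -[_ + A *m x + b - u]addrA -[_ + x - xk]addrA.
  rewrite -[_ + A *m x + _]addrA [A *m x + (b - u)]addrA /l.
  rewrite [edot (A^T *m _ + _) v]edotDl -edot_mulmx.
  move: (A *m x + b - u) (x - xk) (A *m v) => r e w.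
  rewrite !sqr_enorm !(edotDl, edotDr, edotZl, edotZr).
  rewrite (edotC w r) (edotC v e).
  by field.
apply/colP => i; rewrite [LHS]mxE [RHS]mxE [grad f x i 0]mxE.
set v := delta_mx i 0.
have dQ : is_derive x v Q (edot l v) by apply: is_derive_quadratic => t; exact: QE.
have -> : (subproblem f A b rho mu xk yk)^~ u = f + Q.
  by apply/funext => z; rewrite /subproblem /Q /= !addrA.
by rewrite deriveD//; [rewrite derive_val edot_delta | exact: diff_derivable].
Qed.

(** The part [G] without [h] is continuous and takes up the whole loss [e]; the [h] term does not
    decrease near the point. *)
Lemma augL_lsc m n (f : 'cV[R]_n -> R) (A : 'M[R]_(m, n)) b
    (lambda rho : R) (xs : 'cV[R]_n) (us ys : 'cV[R]_m) (e : R) :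
  continuous f -> 0 <= lambda -> 0 < e ->
  nbhs (xs, us, ys) [set p | augL f A b lambda rho xs us ys - e
                             < augL f A b lambda rho p.1.1 p.1.2 p.2].
Proof.
move=> cf lambda0 e0.
pose T : topologicalType := ('cV[R]_n * 'cV[R]_m * 'cV[R]_m)%type.
pose r (p : T) := A *m p.1.1 + b - p.1.2.
pose G (p : T) := f p.1.1 + edot p.2 (r p) + rho / 2 * edot (r p) (r p).
have cx : continuous (fun p : T => p.1.1).
  by move=> p; apply: continuous_comp; exact: cvg_fst.
have cu : continuous (fun p : T => p.1.2).
  by move=> p; apply: continuous_comp; [exact: cvg_fst | exact: cvg_snd].
have cy : continuous (fun p : T => p.2) by move=> p; exact: cvg_snd.
have coord k (F : T -> 'cV[R]_k) i : continuous F -> continuous (fun p => F p i 0).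
  move=> cF p; apply: (@continuous_comp T 'cV[R]_k R F (fun z => z i 0)).
    exact: cF.
  exact: coord_continuous.
have cr i : continuous (fun p => r p i 0).
  have -> : (fun p => r p i 0) = (fun p : T => (A *m p.1.1) i 0) + cst (b i 0)
      - (fun p : T => p.1.2 i 0).
    by apply/funext => p; rewrite /r mxE [X in X + _]mxE [X in _ + X]mxE.
  move=> p; apply: continuousB; last exact: coord.
  apply: continuousD; last exact: cst_continuous.
  by apply: continuous_mulmx_coord => j; exact: coord.
have cyr : continuous (fun p => edot p.2 (r p)).
  by apply: continuous_edot => // i; exact: coord.
have crr : continuous (fun p => edot (r p) (r p)) by exact: continuous_edot.
have cG : continuous G.
  have -> : G = (f \o (fun p : T => p.1.1)) + (fun p => edot p.2 (r p))
      + (cst (rho / 2) \* (fun p => edot (r p) (r p))) by [].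
  move=> p; apply: continuousD; first apply: continuousD.
  - by apply: continuous_comp; [exact: cx | exact: cf].
  - exact: cyr.
  - by apply: continuousM; [exact: cst_continuous | exact: crr].
have nG := cvgr_gt _ (cG (xs, us, ys)) (G (xs, us, ys) - e).
have nh : nbhs (xs, us, ys) [set p : T | h us <= h p.1.2].
  exact: (cu (xs, us, ys) _ (h_lsc us)).
have {}nG : nbhs (xs, us, ys) [set p : T | G (xs, us, ys) - e < G p].
  by apply: nG; rewrite ltrBlDr ltrDl.
apply: filterS2 nG nh => p /= Gp hp.
rewrite /augL !sqr_enorm -/(r p) -/(r (xs, us, ys)) -/(G p) -/(G (xs, us, ys)).
rewrite addrAC ltr_leD// ler_wpM2l//.
Qed.

End Euclidean.

(** * Dual estimate and descent of the merit function along iNALM *)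

Section iNALM.
Context {R : realType} {n m : nat} (f : 'cV[R]_n -> R) (A : 'M[R]_(m, n))
  (b : 'cV[R]_m) (lambda mu rho sigmaf lf gamma alpha t c1 c2 c3 c4 beta : R)
  (eps : nat -> R) (x : nat -> 'cV[R]_n) (u y : nat -> 'cV[R]_m).
Context (mu0 : 0 < mu) (df : forall z, differentiable f z)
  (lipf : elipschitz lf (grad f)) (gamma0 : 0 < gamma)
  (gammaE : min_eigenvalue (A *m A^T) (gamma ^+ 2))
  (c3E : c3 = (mu + lf + c1) / gamma) (c4E : c4 = (mu + c1) / gamma)
  (rhoE : 8 * (c3 ^+ 2 + c4 ^+ 2) / mu < rho) (betaE : beta = 4 * c4 ^+ 2 / rho)
  (alg : inalm f A b lambda rho mu sigmaf alpha t c1 c2 eps x u y).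

(** At [k = 0] the predecessor [k.-1] is [0] again; only the values [V k.+1] enter the lemmas. *)
Let V k := merit f A b lambda rho beta (x k) (u k) (y k) (x k.-1).
Let D k := enorm (x k.+1 - x k).
Let E k := enorm (y k.+1 - y k).

Lemma inalm_rho_gt0 : 0 < rho.
Proof.
apply: le_lt_trans rhoE; rewrite divr_ge0 ?(ltW mu0)// mulr_ge0//.
by rewrite addr_ge0// sqr_ge0.
Qed.

Lemma inalm_multiplier k :
  y k.+1 = y k + rho *: (A *m x k.+1 + b - u k.+1).
Proof. by have [zx [zu [_ _ _ ->]]] := alg k. Qed.

(** Whether or not the GSNewton sequence stalls, the new iterate passes the first stopping
    inequality; the multiplier update puts it in this form. *)
Lemma inalm_stationarity k :
  enorm (grad f (x k.+1) + (A^T *m y k.+1 + mu *: (x k.+1 - x k))) <= c1 * D k.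
Proof.
rewrite inalm_multiplier -(gradx_subproblem A b rho mu (x k) (y k) (u k.+1))//.
have [zx [zu [_ go stall _ _]]] := alg k.
have [st|nst] := pselect (exists ubar : 'cV[R]_m,
  (zx j @[j --> \oo] --> x k) /\ (zu j @[j --> \oo] --> ubar)).
  by have [_ []] := stall st.
by rewrite /D; have [jk [[]]] := go nst => r1 _ _ _ -> ->.
Qed.

(* Subtract two consecutive approximate stationarity relations. *)
Lemma inalm_dual_step k : E k.+1 <= c3 * D k.+1 + c4 * D k.
Proof.
rewrite -(ler_pM2l gamma0) (le_trans (enorm_trmx_ge gamma0 gammaE _))//.
(* The five terms bound, in order, two residuals, the change of [grad f], and two proximal terms. *)
have -> : gamma * (c3 * D k.+1 + c4 * D k) =
    c1 * D k.+1 + c1 * D k + lf * D k.+1 + mu * D k.+1 + mu * D k.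
  by rewrite c3E c4E; field; exact: lt0r_neq0.
have := inalm_stationarity k; have := inalm_stationarity k.+1.
set G1 := grad f _ + _; set G0 := grad f _ + _ => G1le G0le.
have -> : A^T *m (y k.+2 - y k.+1) = G1 - G0 - (grad f (x k.+2) - grad f (x k.+1))
    - mu *: (x k.+2 - x k.+1) + mu *: (x k.+1 - x k).
  rewrite mulmxBr /G1 /G0; apply/colP => i; rewrite !mxE; ring.
have lipG := lipf (x k.+2) (x k.+1).
have dist0 : enorm (mu *: (x k.+1 - x k)) = mu * D k by rewrite enormZ// ltW.
have dist1 : enorm (mu *: (x k.+2 - x k.+1)) = mu * D k.+1 by rewrite enormZ// ltW.
apply: le_trans (enormD _ _) _; rewrite dist0 lerD2r.
apply: le_trans (enormB _ _) _; rewrite dist1 lerD2r.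
apply: le_trans (enormB _ _) _; rewrite lerD//.
by apply: le_trans (enormB _ _) _; rewrite lerD.
Qed.

(** Updating the multiplier raises [augL] by [rho * enorm r ^+ 2 = E k.+1 ^+ 2 / rho], at most
    [2 * P * D k.+1 ^+ 2 + 2 * W * D k ^+ 2]. As [beta / 2 = 2 * W], the last term is already in
    [V k.+1]; what is left of [mu / 2] is [mu / 2 - 2 * (P + W)], at least [mu / 4]. *)
Lemma inalm_merit_descent k : V k.+2 + mu / 4 * D k.+1 ^+ 2 <= V k.+1.
Proof.
have rho0 := inalm_rho_gt0.
have [_ [_ [_ _ _ _ step]]] := alg k.+1.
move: step; rewrite /V /merit /= subrr enorm0 -/(D k.+1) -/(D k).
set P := c3 ^+ 2 / rho; set W := c4 ^+ 2 / rho.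
have PW : 8 * (P + W) <= mu.
  move: rhoE; rewrite ltr_pdivrMr// => rhoE'.
  rewrite /P /W -mulrDl mulrA ler_pdivrMr//; lra.
set r := A *m x k.+2 + b - u k.+2.
have Er : rho * enorm r = E k.+1.
  by rewrite /E (inalm_multiplier k.+1) addrC addKr enormZ// ltW.
have -> : augL f A b lambda rho (x k.+2) (u k.+2) (y k.+2) =
    augL f A b lambda rho (x k.+2) (u k.+2) (y k.+1) + rho * enorm r ^+ 2.
  by rewrite /augL (inalm_multiplier k.+1) -/r edotDl edotZl sqr_enorm; ring.
have rle : rho * enorm r ^+ 2 <= 2 * P * D k.+1 ^+ 2 + 2 * W * D k ^+ 2.
  have E2 : E k.+1 ^+ 2 <= (c3 * D k.+1 + c4 * D k) ^+ 2.
    rewrite ler_sqr ?nnegrE ?enorm_ge0 ?inalm_dual_step//.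
    exact: le_trans (enorm_ge0 _) (inalm_dual_step k).
  have := sqr_ge0 (c3 * D k.+1 - c4 * D k) => sq.
  have -> : rho * enorm r ^+ 2 = E k.+1 ^+ 2 / rho.
    by rewrite -Er; field; exact: lt0r_neq0.
  rewrite ler_pdivrMr// (le_trans E2)// /P /W.
  rewrite [leRHS](_ : _ = 2 * (c3 * D k.+1) ^+ 2 + 2 * (c4 * D k) ^+ 2); last first.
    by field; exact: lt0r_neq0.
  move: sq; lra.
have -> : beta = 4 * W by rewrite betaE /W mulrA.
have DD : 8 * (P + W) * D k.+1 ^+ 2 <= mu * D k.+1 ^+ 2.
  by rewrite ler_wpM2r// sqr_ge0.
lra.
Qed.

Lemma inalm_merit_nonincreasing k d : V (k + d).+1 <= V k.+1.
Proof.
elim: d => [|d]; first by rewrite addn0.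
apply: le_trans; rewrite addnS (le_trans _ (inalm_merit_descent _))// lerDl.
by rewrite mulr_ge0 ?divr_ge0 ?sqr_ge0// ltW.
Qed.

(** Were [V k.+1] smaller, semicontinuity would give a late [j] whose [augL], hence also [V j] since
    [beta] is nonnegative, exceeds [V k.+1], against monotonicity. *)
Lemma inalm_merit_ge (xs : 'cV[R]_n) (us ys : 'cV[R]_m) k : 0 < lambda ->
  cluster ((x k, u k, y k) @[k --> \oo]) (xs, us, ys) ->
  merit f A b lambda rho beta xs us ys xs <= V k.+1.
Proof.
move=> lambda0 cl; rewrite {1}/merit subrr enorm0 expr0n mulr0 addr0 leNgt.
apply/negP => lt; have cf : continuous f.
  by move=> z; exact: differentiable_continuous.
have e0 : 0 < augL f A b lambda rho xs us ys - V k.+1 by rewrite subr_gt0.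
have [j kj /=] :=
  cluster_seq_nbhs k.+1 cl (augL_lsc A b rho xs us ys cf (ltW lambda0) e0).
rewrite subKr ltNge => /negP; apply.
have := inalm_merit_nonincreasing k (j - k.+1); rewrite -addSn subnKC//.
apply: le_trans; rewrite /V /merit lerDl mulr_ge0 ?sqr_ge0//.
by rewrite divr_ge0// betaE divr_ge0 ?(ltW inalm_rho_gt0)// mulr_ge0// sqr_ge0.
Qed.

End iNALM.

(** * Geometric steps and rates for the three sequences *)

Theorem theorem17 (R : realType) (n m : nat)
  (f : 'cV[R]_n -> R) (A : 'M[R]_(m, n)) (b : 'cV[R]_m)
  (lambda mu rho sigmaf lf Lf gamma alpha t lg c1 c2 c3 c4 beta : R)
  (eps : nat -> R)
  (x : nat -> 'cV[R]_n) (u y : nat -> 'cV[R]_m)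
  (xs : 'cV[R]_n) (us ys : 'cV[R]_m)
  (q cnu : R) (knu : nat) :
  0 < lambda -> 0 < mu ->
  (* (a) *)
  twice_cont_diff f ->
  weakly_convex sigmaf f ->
  elipschitz lf (grad f) ->
  hess_lipschitz Lf f ->
  (* (b) *)
  row_free A ->
  0 < gamma ->
  min_eigenvalue (A *m A^T) (gamma ^+ 2) ->
  (* (c) *)
  coercive f ->
  (* (d) *)
  0 < c1 -> 0 < c2 ->
  sigmaf < mu ->
  c3 = (mu + lf + c1) / gamma ->
  c4 = (mu + c1) / gamma ->
  Num.max (8 * (c3 ^+ 2 + c4 ^+ 2) / mu) (4 * lf / gamma ^+ 2) < rho ->
  beta = 4 * c4 ^+ 2 / rho ->
  (* lg is a Lipschitz modulus of all the gradients of the g_k *)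
  0 < lg ->
  (forall k, elipschitz lg
     (grad (stacked (subproblem f A b rho mu (x k) (y k))))) ->
  0 < alpha < lg^-1 ->
  0 < t < 2 / lg ->
  (forall k, 0 < eps k) ->
  eps k @[k --> \oo] --> (0 : R) ->
  inalm f A b lambda rho mu sigmaf alpha t c1 c2 eps x u y ->
  (* accumulation point with the second-order sufficient condition *)
  cluster ((x k, u k, y k) @[k --> \oo]) (xs, us, ys) ->
  (forall d, critical_cone A us ys d -> d <> 0 ->
     0 < (d^T *m hess f xs *m d) 0 0) ->
  0 < q < 1 ->
  0 < cnu ->
  (forall k, (0 < k)%N -> (knu <= k)%N ->
     merit f A b lambda rho beta (x k) (u k) (y k) (x k.-1)
     - merit f A b lambda rho beta xs us ys xs <= cnu * q ^+ k) ->
  exists (kstar : nat) (cx cu cy : R),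
    [/\ 0 < cx, 0 < cu, 0 < cy &
        forall k, (kstar <= k)%N ->
          [/\ enorm (x k - xs) <= cx * Num.sqrt q ^+ k,
              enorm (y k - ys) <= cy * Num.sqrt q ^+ k &
              enorm (u k - us) <= cu * Num.sqrt q ^+ k]].

Proof.
move=> lambda0 mu0 [df _ _] _ lipf _ _ gamma0 gammaE _ c10 c20 _ c3E c4E.
rewrite gt_max => /andP[rhoE _] betaE _ _ _ _ _ _ alg cl _ /andP[q0 q1] cnu0 Vq.
have rho0 := inalm_rho_gt0 mu0 rhoE.
set r := Num.sqrt q; have r0 : 0 < r by rewrite sqrtr_gt0.
have r1 : r < 1 by rewrite -sqrtr1 ltr_sqrt.
have r01 : 0 <= r < 1 by rewrite ltW.
(* The successor forces [k] to be positive from [K] on; [C] comes from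
   [mu / 4 * D k ^+ 2 <= cnu * q ^+ k]. *)
pose K := knu.+1; pose C := Num.sqrt (cnu / (mu / 4)).
have C0 : 0 <= C by exact: sqrtr_ge0.
have xstep k : (K <= k)%N -> enorm (x k.+1 - x k) <= C * r ^+ k.
  case: k => // k Kk.
  have := inalm_merit_descent mu0 df lipf gamma0 gammaE c3E c4E rhoE betaE alg k.
  have := inalm_merit_ge mu0 df lipf gamma0 gammaE c3E c4E rhoE betaE alg k.+1
    lambda0 cl.
  have := Vq k.+1 isT (ltnW Kk) => /= Vle Vge Vdesc.
  rewrite -ler_sqr ?nnegrE ?mulr_ge0 ?exprn_ge0 ?enorm_ge0 ?(ltW r0)//.
  have -> : (C * r ^+ k.+1) ^+ 2 = cnu * q ^+ k.+1 / (mu / 4).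
    have C2 : C ^+ 2 = cnu / (mu / 4) by rewrite sqr_sqrtr// !divr_ge0// ltW.
    have r2 : r ^+ 2 = q by rewrite sqr_sqrtr// ltW.
    by rewrite exprMn C2 -r2 exprAC mulrAC.
  rewrite ler_pdivlMr ?divr_gt0// mulrC.
  lra.
(* Dividing by [r] converts [r ^+ k], from the earlier step in the dual estimate, into [r ^+ k.+1].
   That look-back also costs one index below. *)
pose Cy := (`|c3| + `|c4| / r) * C.
have Cy0 : 0 <= Cy by rewrite mulr_ge0// addr_ge0// divr_ge0// ltW.
have ystep k : (K.+1 <= k)%N -> enorm (y k.+1 - y k) <= Cy * r ^+ k.
  case: k => // k Kk.
  have := inalm_dual_step mu0 df lipf gamma0 gammaE c3E c4E alg k.
  move=> /le_trans; apply.
  have -> : Cy * r ^+ k.+1 = `|c3| * (C * r ^+ k.+1) + `|c4| * (C * r ^+ k).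
    by rewrite /Cy exprS; field; exact: lt0r_neq0.
  apply: lerD; apply: (le_trans (ler_wpM2r (enorm_ge0 _) (ler_norm _)));
    by rewrite ler_wpM2l// xstep// ltnW.
have [CA CA0 CAle] := enorm_mulmx_bounded A.
(* Solving the multiplier update for [u] makes its step a combination of one step of [x] and two
   consecutive steps of [y], hence [K.+2]. *)
pose Cu := CA * C + rho^-1 * (Cy + Cy / r).
have Cu0 : 0 <= Cu.
  by rewrite addr_ge0 ?mulr_ge0 ?invr_ge0 ?addr_ge0 ?divr_ge0// ltW.
have ustep k : (K.+2 <= k)%N -> enorm (u k.+1 - u k) <= Cu * r ^+ k.
  case: k => // k Kk.
  have uE j : u j.+1 = A *m x j.+1 + b - rho^-1 *: (y j.+1 - y j).
    rewrite (inalm_multiplier alg) [y j + _]addrC addrK scalerA mulVf ?lt0r_neq0//.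
    by rewrite scale1r opprB addrC subrK.
  have -> : u k.+2 - u k.+1 = A *m (x k.+2 - x k.+1)
      - rho^-1 *: ((y k.+2 - y k.+1) - (y k.+1 - y k)).
    by rewrite !uE mulmxBr; apply/colP => i; rewrite !mxE; ring.
  rewrite (le_trans (enormB _ _))// enormZ ?invr_ge0 ?(ltW rho0)//.
  have -> : Cu * r ^+ k.+1 = CA * (C * r ^+ k.+1)
      + rho^-1 * (Cy * r ^+ k.+1 + Cy * r ^+ k).
    by rewrite /Cu exprS; field; rewrite !lt0r_neq0.
  apply: lerD.
    by rewrite (le_trans (CAle _))// ler_wpM2l// xstep// ltnW// ltnW.
  rewrite ler_wpM2l ?invr_ge0 ?(ltW rho0)// (le_trans (enormB _ _))//.
  by rewrite lerD// ystep// ltnW.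
(* A product of Euclidean balls is a neighbourhood of the cluster point. *)
have close e N : 0 < e -> exists2 k, (N <= k)%N &
    [/\ enorm (x k - xs) < e, enorm (y k - ys) < e & enorm (u k - us) < e].
  move=> e0; pose near_e k (p : 'cV[R]_k) := [set z | enorm (z - p) < e].
  have near_eP k (p : 'cV[R]_k) : nbhs p (near_e k p) by exact: near_enorm_lt.
  have [|k Nk [[xe ue] ye]] := @cluster_seq_nbhs _ _ _
    ((near_e n xs `*` near_e m us) `*` near_e m ys) N cl; last by exists k.
  exists (near_e n xs `*` near_e m us, near_e m ys) => //; split=> //=.
  exists (near_e n xs, near_e m us); [split; exact: near_eP|by []].
(* Adding [1] makes the final constants strictly positive when [C'] is only known to be
   nonnegative. *)
have rate C' : 0 <= C' -> 0 < C' / (1 - r) + 1.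
  by move=> C'0; rewrite ltr_wpDl// divr_ge0// subr_ge0 ltW.
have rateW C' k a : a <= C' / (1 - r) * r ^+ k -> a <= (C' / (1 - r) + 1) * r ^+ k.
  by move=> /le_trans; apply; rewrite ler_wpM2r ?exprn_ge0 ?(ltW r0)// lerDl.
exists K.+2, (C / (1 - r) + 1), (Cu / (1 - r) + 1), (Cy / (1 - r) + 1).
split; [exact: rate | exact: rate | exact: rate | move=> k Kk].
split; apply: rateW.
- apply: (geometric_rate C0 r01 xstep) => [e N /(close e N)[j Nj []]|].
    by exists j.
  by rewrite ltnW// ltnW.
- apply: (geometric_rate Cy0 r01 ystep) => [e N /(close e N)[j Nj []]|].
    by exists j.
  by rewrite ltnW.
- apply: (geometric_rate Cu0 r01 ustep) => [e N /(close e N)[j Nj []]|] //.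
  by exists j.
Qed.
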